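(* There exists a sequence $(a_n)_{n\geq 0}$ of positive real numbers with $a_0=1$, $a_{i+j}\leq a_ia_j$ for all integers $i,j\geq 0$, and $\lim_{n\to\infty}a_n^{1/n}=1$, such that $0\in\sigma(x)$ whenever $x$ is an element of a Banach algebra with $\lVert x^n\rVert=a_n$ for all integers $n\geq 0$.
   Context: Banach algebras are complex and unital, with submultiplicative norm and $\lVert 1\rVert=1$. $\sigma(x)=\{\lambda\in\mathbb{C}:\lambda\cdot 1-x\text{ is not invertible}\}$ is the spectrum of $x$. *)

(* Defs.v *)
From HB Require Import structures.
From mathcomp Require Import all_boot all_order all_algebra.
From mathcomp Require Import all_classical all_reals all_analysis.
From mathcomp Require Export complex.

Set Implicit Arguments.
Unset Strict Implicit.
Unset Printing Implicit Defensive.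

Import Order.TTheory GRing.Theory Num.Theory.
Import numFieldNormedType.Exports.

Local Open Scope classical_set_scope.
Local Open Scope ring_scope.

(* Hierarchy-Builder cannot join [CompleteNormedModule K] and [GRing.Algebra K]
   here: a structure between ring and normed module would have to be declared
   before [Num.NumDomain]. Hence the product is part of this mixin, and
   the [algType K] structure is derived below.
   The norm of a normed module over [K] takes its values in [K] itself: over
   [K := R[i]], norms are nonnegative elements of [R[i]]. *)
HB.mixin Record CompleteNormedModule_isBanachAlgebra
    (K : numFieldType) A & CompleteNormedModule K A := {
  banach_one : A;
  banach_mul : A -> A -> A;
  banach_mulA : associative banach_mul;
  banach_mul1x : left_id banach_one banach_mul;
  banach_mulx1 : right_id banach_one banach_mul;
  banach_mulDl : left_distributive banach_mul +%R;
  banach_mulDr : right_distributive banach_mul +%R;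
  banach_scaleAl : forall (k : K) (x y : A),
    k *: banach_mul x y = banach_mul (k *: x) y;
  banach_scaleAr : forall (k : K) (x y : A),
    k *: banach_mul x y = banach_mul x (k *: y);
  banach_ler_normM : forall x y : A, `|banach_mul x y| <= `|x| * `|y|;
  banach_normr1 : `|banach_one| = 1
}.

#[short(type="banachAlgType")]
HB.structure Definition BanachAlgebra (K : numFieldType) :=
  {A of CompleteNormedModule K A & CompleteNormedModule_isBanachAlgebra K A}.

Section BanachAlgebraIsAlgebra.
Variables (K : numFieldType) (A : banachAlgType K).

Let banach_oner_neq0 : (banach_one : A) != 0.
Proof. by rewrite -normr_eq0 banach_normr1 oner_eq0. Qed.

#[non_forgetful_inheritance]
HB.instance Definition _ := GRing.Zmodule_isNzRing.Build (BanachAlgebra.sort A)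
  (@banach_mulA K A) (@banach_mul1x K A) (@banach_mulx1 K A)
  (@banach_mulDl K A) (@banach_mulDr K A) banach_oner_neq0.

#[non_forgetful_inheritance]
HB.instance Definition _ :=
  GRing.Lmodule_isLalgebra.Build K (BanachAlgebra.sort A) (@banach_scaleAl K A).

#[non_forgetful_inheritance]
HB.instance Definition _ :=
  GRing.Lalgebra_isAlgebra.Build K (BanachAlgebra.sort A) (@banach_scaleAr K A).

End BanachAlgebraIsAlgebra.

Section Spectrum.
Variables (K : numFieldType) (A : banachAlgType K).

(* [GRing.unit] would require a [unitRingType] structure on [A]. *)
Definition invertible (x : A) : Prop := exists y : A, y * x = 1 /\ x * y = 1.

Definition spectrum (x : A) : set K := [set l | ~ invertible (l *: 1 - x)].

End Spectrum.

(* Main.v *)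
Require Import Defs.
From mathcomp Require Import all_boot all_order all_algebra.
From mathcomp Require Import all_classical all_reals all_analysis.
From mathcomp Require Import zify ring.

(** The point is that inverting [x] costs only a bounded factor: if [y] is a
    left inverse of [x] then [`|x ^+ n| <= `|y| * `|x ^+ n.+1|], so the norms
    of the powers of an invertible element never drop by more than the fixed
    factor [`|y|] in one step (lemma [norm_expr_le_inverse]).  It is therefore
    enough to find a submultiplicative sequence of subexponential growth whose
    one-step drops [a n / a n.+1] are unbounded.

    The sequence is [a n = 2 ^ s n], where [s n] is the sum of the binary
    digits of [n].  Adding in base two can only lose digits through carries, so
    [s] is subadditive.  A number with [s] ones is at least [2 ^ s - 1], so
    [1 <= a n <= n + 1], which forces [a n `^ n^-1] to [1].  Finally the carry
    in [(2 ^ k - 1) + 1 = 2 ^ k] turns [k] ones into a single one, so the norm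
    would drop there by the factor [2 ^ (k - 1)].

    The digit sum enters through Legendre's formula
    [s n = n - v_2 (n!)], under which subadditivity is just the divisibility
    of [(i + j)!] by [i! * j!]. *)

Import Order.TTheory GRing.Theory Num.Theory.
Import numFieldNormedType.Exports.

Local Open Scope classical_set_scope.
Local Open Scope ring_scope.
Local Open Scope complex_scope.

(** By Legendre's formula this is the sum of the binary digits of [n]; the
    truncated subtraction is exact by [logn2_fact_le]. *)
Definition binary_digit_sum (n : nat) : nat := (n - logn 2 n`!)%N.

Lemma logn2_fact_double (m : nat) : logn 2 (m.*2)`! = (m + logn 2 m`!)%N.
Proof.
elim: m => [|m IHm]; first by rewrite double0 fact0 logn1.
rewrite doubleS !factS !lognM ?muln_gt0 ?fact_gt0// IHm.
have odd_logn : logn 2 m.*2.+1 = 0%N.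
  by rewrite lognE dvdn2 /= odd_double.
have -> : m.*2.+2 = (2 * m.+1)%N by rewrite mul2n doubleS.
by rewrite lognM// (@logn_prime 2 2)// eqxx odd_logn; lia.
Qed.

Lemma logn2_fact_doubleS (m : nat) : logn 2 (m.*2.+1)`! = (m + logn 2 m`!)%N.
Proof.
by rewrite factS lognM ?fact_gt0// lognE dvdn2 /= odd_double logn2_fact_double.
Qed.

Lemma logn2_fact_le (n : nat) : (logn 2 n`! <= n)%N.
Proof.
elim/ltn_ind: n => n IHn.
case: (posnP n) => [->|n_gt0]; first by rewrite fact0 logn1.
have /IHn le_half : (n./2 < n)%N by lia.
rewrite -[n in logn 2 n`!]odd_double_half; case: (odd n).
  by rewrite add1n logn2_fact_doubleS; lia.
by rewrite add0n logn2_fact_double; lia.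
Qed.

Lemma binary_digit_sum_double (m : nat) :
  binary_digit_sum m.*2 = binary_digit_sum m.
Proof. by rewrite /binary_digit_sum logn2_fact_double; lia. Qed.

Lemma binary_digit_sum_doubleS (m : nat) :
  binary_digit_sum m.*2.+1 = (binary_digit_sum m).+1.
Proof.
rewrite /binary_digit_sum logn2_fact_doubleS.
by have := logn2_fact_le m; lia.
Qed.

(** The 2-adic valuation of the integer ['C(i + j, i)], which counts the
    carries in [i + j], is nonnegative. *)
Lemma binary_digit_sum_subadditive (i j : nat) :
  (binary_digit_sum (i + j) <= binary_digit_sum i + binary_digit_sum j)%N.
Proof.
have := bin_fact (leq_addr j i); rewrite addKn => /(congr1 (logn 2)).
rewrite !lognM ?muln_gt0 ?fact_gt0 ?bin_gt0 ?leq_addr// /binary_digit_sum.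
by have := logn2_fact_le i; have := logn2_fact_le j; lia.
Qed.

Lemma binary_digit_sum_exp2 (k : nat) : binary_digit_sum (2 ^ k) = 1%N.
Proof.
by elim: k => [//|k IHk]; rewrite expnS mul2n binary_digit_sum_double.
Qed.

Lemma binary_digit_sum_exp2_pred (k : nat) :
  binary_digit_sum (2 ^ k).-1 = k.
Proof.
elim: k => [//|k IHk].
have -> : ((2 ^ k.+1).-1 = (2 ^ k).-1.*2.+1)%N.
  by rewrite expnS mul2n; have := expn_gt0 2 k; lia.
by rewrite binary_digit_sum_doubleS IHk.
Qed.

Lemma exp2_binary_digit_sum_le (n : nat) :
  (2 ^ binary_digit_sum n <= n.+1)%N.
Proof.
elim/ltn_ind: n => n IHn.
case: (posnP n) => [->//|n_gt0].
have /IHn le_half : (n./2 < n)%N by lia.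
rewrite -[n in binary_digit_sum n]odd_double_half; case odd_n: (odd n).
  by rewrite add1n binary_digit_sum_doubleS expnS; lia.
by rewrite add0n binary_digit_sum_double; lia.
Qed.

(** The second-order bound [1 + x ^+ 2 / 2 <= expR x] at [x = sqrt (2 n)] gives
    [n + 1 <= expR (sqrt (2 n))], hence an [n]-th root at most
    [expR (sqrt (2 / n))]. *)
Lemma succn_root_le (R : realType) (n : nat) : (0 < n)%N ->
  (n.+1%:R : R) `^ n%:R^-1 <= expR (Num.sqrt (2 * n%:R^-1)).
Proof.
move=> n_gt0; have nR_gt0 : 0 < n%:R :> R by rewrite ltr0n.
set t := Num.sqrt _.
have t_ge0 : 0 <= t by exact: sqrtr_ge0.
have t2 : t ^+ 2 = 2 * n%:R^-1.
  by rewrite sqr_sqrtr// mulr_ge0// invr_ge0 ltW.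
have succn_le : n.+1%:R <= expR (t * n%:R).
  apply: le_trans (expR_ge1Dxn 1 (mulr_ge0 t_ge0 (ltW nR_gt0))).
  rewrite exprMn t2 -natr1 addrC lerD2l (_ : 2`! = 2)%N//.
  by rewrite le_eqVlt; apply/orP; left; apply/eqP; field; rewrite gt_eqF.
have -> : expR t = expR (t * n%:R) `^ n%:R^-1.
  by rewrite -expRM mulfK// gt_eqF.
by apply: ge0_ler_powR => //; rewrite ?nnegrE ?invr_ge0 ?expR_ge0 ?ltW.
Qed.

Lemma cvg_root_le_succn (R : realType) (u : nat -> R) :
  (forall n, 1 <= u n <= n.+1%:R) -> (u n) `^ n%:R^-1 @[n --> \oo] --> (1 : R).
Proof.
move=> u_bounds.
apply: (@squeeze_cvgr _ _ _ _ (fun=> 1)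
  (fun n => expR (Num.sqrt (2 * n%:R^-1)))).
- near=> n; have /andP[u_ge1 u_le] := u_bounds n.
  have n_gt0 : (0 < n)%N by near: n; exact: nbhs_infty_gt.
  apply/andP; split.
    suff : 1 `^ n%:R^-1 <= u n `^ n%:R^-1 by rewrite powR1.
    by apply: ge0_ler_powR => //; rewrite ?nnegrE ?invr_ge0// (le_trans _ u_ge1).
  apply: le_trans (succn_root_le R n n_gt0).
  apply: ge0_ler_powR => //; rewrite ?nnegrE ?invr_ge0//.
  exact: le_trans u_ge1.
- exact: cvg_cst.
- have inv_cvg0 : (2 * n%:R^-1 : R) @[n --> \oo] --> (0 : R).
    rewrite -(mulr0 2); apply: cvgMl_tmp.
    by rewrite -cvg_shiftS; exact: cvg_harmonic.
  have sqrt_cvg0 : Num.sqrt (2 * n%:R^-1 : R) @[n --> \oo] --> (0 : R).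
    by rewrite -(sqrtr0 R); apply: continuous_cvg inv_cvg0; exact: sqrt_continuous.
  rewrite -[X in _ --> X](@expR0 R).
  by apply: continuous_cvg sqrt_cvg0; exact: continuous_expR.
Unshelve. all: by end_near. Qed.

Lemma norm_expr_le_inverse (K : numFieldType) (A : banachAlgType K)
    (x y : A) (n : nat) :
  y * x = 1 -> `|x ^+ n| <= `|y| * `|x ^+ n.+1|.
Proof.
move=> yx1; rewrite -[x ^+ n]mul1r -yx1 -mulrA -exprS.
exact: banach_ler_normM.
Qed.

Theorem theorem2p4 (R : realType) :
  exists a : nat -> R,
    (forall n : nat, 0 < a n) /\
    a 0%N = 1 /\
    (forall i j : nat, a (i + j)%N <= a i * a j) /\
    ((a n) `^ (n%:R)^-1 @[n --> \oo] --> (1 : R)) /\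
    (forall (A : banachAlgType R[i]) (x : A),
       (forall n : nat, `|x ^+ n| = (a n)%:C) -> spectrum x 0).
Proof.
exists (fun n => (2 ^ binary_digit_sum n)%:R).
split; first by move=> n; rewrite ltr0n expn_gt0.
split; first by [].
split.
  move=> i j; rewrite -natrM -expnD ler_nat leq_exp2l//.
  exact: binary_digit_sum_subadditive.
split.
  apply: cvg_root_le_succn => n; rewrite ler1n expn_gt0 ler_nat.
  exact: exp2_binary_digit_sum_le.
move=> A x norm_x; rewrite /spectrum /= scale0r sub0r => -[y [yx1 _]].
(* [y] inverts [0 *: 1 - x = - x], so [- y] inverts [x]. *)
have {}yx1 : - y * x = 1 by rewrite mulNr -mulrN.
pose M := complex.Re `|- y|.
have norm_y : `|- y| = M%:C.
  by rewrite /M; have /complex_realP[r ->] := normr_real (- y).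
have drop k : (2 ^ k)%:R <= M * 2.
  have := norm_expr_le_inverse _ _ _ _ (2 ^ k).-1 yx1.
  rewrite prednK ?expn_gt0// !norm_x norm_y -rmorphM lecR.
  by rewrite binary_digit_sum_exp2 binary_digit_sum_exp2_pred expn1.
have := drop (Num.bound (M * 2)); apply/negP; rewrite -ltNge natrX.
exact: upper_nthrootP.
Qed.
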